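(* Let $X=\{1,\dots,n\}$ be a finite state set, let $r: X\to\mathbb{R}$ be a reward function, identified with the vector $r=(r(1),\dots,r(n))^\top\in\mathbb{R}^n$, and let $x^*\in X$ be a fixed state. Let $P\in\mathbb{R}^{n\times n}$ be a stochastic matrix (row $i$, column $j$ is the probability of transition from state $i$ to state $j$) whose Markov chain is ergodic, i.e., irreducible, recurrent and aperiodic. Define $P'$ to be the matrix equal to $P$ except that the column corresponding to $x^*$ is zeroed, i.e., $P'(i,x^* )=0$ for $i=1,\dots,n$ and $P'(i,j)=P(i,j)$ for $j\neq x^*$. Let $J,V\in\mathbb{R}^n$ be the value function and the trajectory variance function, viewed as vectors with entries $J(x)=\mathbb{E}[B\mid x_0=x]$ and $V(x)=\mathrm{Var}[B\mid x_0=x]$, $x\in X$. Then: (a) the matrix $I-P'$ is invertible; (b) $J=(I-P')^{-1}r$; (c) $V=(I-P')^{-1}\rho$, where $\rho\in\mathbb{R}^n$ is given by $$\rho(x)=\sum_{y\in X}P'(y|x)J(y)^2-\Big(\sum_{y\in X}P'(y|x)J(y)\Big)^2,\qquad x\in X,$$ with $P'(y|x)$ denoting the $(x,y)$ entry of $P'$.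
   Context: $(x_k)_{k\ge 0}$ denotes the Markov chain on $X$ with transition matrix $P$ (the chain induced on a finite Markov decision process by a fixed policy). The first passage time to $x^*$ is $\tau=\min\{k>0 : x_k=x^*\}$, and $B=\sum_{k=0}^{\tau-1}r(x_k)$ is the reward accumulated until the (first positive-time) visit to $x^*$. Expectation and variance are with respect to the law of the chain started from $x_0=x$. *)

(* Defs.v *)
From HB Require Import structures.
From mathcomp Require Import all_boot all_order all_algebra.
From mathcomp Require Import all_classical all_reals all_analysis.

Set Implicit Arguments.
Unset Strict Implicit.
Unset Printing Implicit Defensive.

Import Order.TTheory GRing.Theory Num.Theory.
Import numFieldNormedType.Exports.

Local Open Scope classical_set_scope.
Local Open Scope ring_scope.

Definition stochastic (R : realType) (n : nat) (P : 'M[R]_n) : Prop :=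
  (forall i j, 0 <= P i j) /\ (forall i, \sum_j P i j = 1).

Definition irreducible (R : realType) (n : nat) (P : 'M[R]_n) : Prop :=
  forall i j, exists k : nat, 0 < (P ^+ k) i j.

(* For every state i, the gcd of the set {k > 0 | P^k(i, i) > 0} is 1, stated
   as: the only common divisor is 1 (so the set is in particular nonempty,
   as 0 would be a common divisor of the empty set). *)
Definition aperiodic (R : realType) (n : nat) (P : 'M[R]_n) : Prop :=
  forall (i : 'I_n) (d : nat),
    (forall k : nat, (0 < k)%N -> 0 < (P ^+ k) i i -> (d %| k)%N) -> d = 1%N.

(* [x k] is the state at time k and [Pr s] is the law of the chain started
   from s.  The last clause is the Markov property, multiplied out so that
   no conditioning on null events occurs. *)
Definition markov_chain (R : realType) (d : measure_display)
    (Omega : measurableType d) (n : nat) (P : 'M[R]_n)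
    (Pr : 'I_n -> probability Omega R) (x : nat -> Omega -> 'I_n) : Prop :=
  [/\ forall k j, measurable (x k @^-1` [set j]),
      forall s, Pr s [set w | x 0%N w = s] = 1%E &
      forall (s : 'I_n) (k : nat) (h : nat -> 'I_n),
        Pr s [set w | forall i, (i <= k.+1)%N -> x i w = h i] =
        (Pr s [set w | forall i, (i <= k)%N -> x i w = h i] *
         (P (h k) (h k.+1))%:E)%E].

Definition recurrent (R : realType) (d : measure_display)
    (Omega : measurableType d) (n : nat)
    (Pr : 'I_n -> probability Omega R) (x : nat -> Omega -> 'I_n) : Prop :=
  forall s, Pr s [set w | exists2 k, (0 < k)%N & x k w = s] = 1%E.

Definition ergodic (R : realType) (d : measure_display)
    (Omega : measurableType d) (n : nat) (P : 'M[R]_n)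
    (Pr : 'I_n -> probability Omega R) (x : nat -> Omega -> 'I_n) : Prop :=
  [/\ irreducible P, recurrent Pr x & aperiodic P].

Section passage_reward.
Context (R : realType) (d : measure_display) (Omega : measurableType d).
Context (n : nat) (xstar : 'I_n).

(* min {k > 0 | x k w = xstar}, with junk value 0 on the event that xstar is
   never visited at a positive time, which is null for a recurrent
   irreducible chain. *)
Definition first_passage (x : nat -> Omega -> 'I_n) (w : Omega) : nat :=
  match pselect (exists k, (0 < k)%N && (x k w == xstar)) with
  | left visit => ex_minn visit
  | right _ => 0%N
  end.

Definition acc_reward (r : 'cV[R]_n) (x : nat -> Omega -> 'I_n)
    (w : Omega) : R :=
  \sum_(0 <= k < first_passage x w) r (x k w) 0.

Definition value_fun (r : 'cV[R]_n) (Pr : 'I_n -> probability Omega R)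
    (x : nat -> Omega -> 'I_n) : 'cV[R]_n :=
  \col_s fine ('E_(Pr s)[acc_reward r x])%E.

Definition variance_fun (r : 'cV[R]_n) (Pr : 'I_n -> probability Omega R)
    (x : nat -> Omega -> 'I_n) : 'cV[R]_n :=
  \col_s fine ('V_(Pr s)[acc_reward r x])%E.

Definition zero_col (P : 'M[R]_n) : 'M[R]_n :=
  \matrix_(i, j) if j == xstar then 0 else P i j.

End passage_reward.

Definition rho_of (R : realType) (n : nat) (P' : 'M[R]_n) (J : 'cV[R]_n) :
    'cV[R]_n :=
  \col_s (\sum_y P' s y * J y 0 ^+ 2 - (\sum_y P' s y * J y 0) ^+ 2).

(* Main.v *)
Require Import Defs.
From HB Require Import structures.
From mathcomp Require Import all_boot all_order all_algebra.
From mathcomp Require Import all_classical all_reals all_analysis.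
From mathcomp Require Import measurable_realfun.
From mathcomp Require Import ring lra.

Set Implicit Arguments.
Unset Strict Implicit.
Unset Printing Implicit Defensive.

Import Order.TTheory GRing.Theory Num.Theory.
Import numFieldNormedType.Exports.

Local Open Scope classical_set_scope.
Local Open Scope ring_scope.

(* Write Q for the matrix P'.  A maximum principle along the powers of Q makes
   I - Q invertible.  Let [alive m] be the event that the chain has not visited
   xstar at the times 1, ..., m, and let J = r + Q J and S = rho + Q S.
   The Markov property at time m shows that
     M_m = sum_(k < m) [alive k] r(x_k) + [alive m] J(x_m)
   has constant expectation J(s), and that (M_m - J(s))^2 + [alive m] S(x_m)
   has constant expectation S(s).  Both are frozen once xstar is reached, at
   B and (B - J(s))^2 respectively, so it remains to pass to the limit.  The
   second identity for r = 1 bounds the second moments of the truncated passage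
   times uniformly; by monotone convergence their supremum is integrable, which
   shows at once that the passage time is almost surely finite and that
   dominated convergence applies. *)

(** * Invertibility of [I - Q] *)

Section KilledMatrix.
Context (R : realType) (n : nat) (xstar : 'I_n) (P : 'M[R]_n).
Context (stochP : stochastic P).
Let Q := zero_col xstar P.

Lemma stochastic_expr_row_sum k i : \sum_j (P ^+ k) i j = 1.
Proof.
elim: k i => [|k IH] i.
  rewrite (bigD1 i)//= big1 ?addr0 => [|j ji]; rewrite expr0 mxE ?eqxx//.
  by rewrite eq_sym (negbTE ji).
rewrite exprS -mulmxE.
under eq_bigr do rewrite mxE.
rewrite exchange_big/=.
under eq_bigr do rewrite -mulr_sumr IH mulr1.
exact: (proj2 stochP).
Qed.

Lemma zero_col_expr_bounds k i j : 0 <= (Q ^+ k) i j <= (P ^+ k) i j.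
Proof.
have [P0 _] := stochP.
have QP a b : 0 <= Q a b <= P a b by rewrite mxE; case: ifP; rewrite lexx P0.
elim: k i => [|k IH] i.
  by rewrite !expr0 lexx andbT mxE ler0n.
rewrite !exprS -!mulmxE !mxE; apply/andP; split.
  apply: sumr_ge0 => l _; apply: mulr_ge0; first by case/andP: (QP i l).
  by case/andP: (IH l).
apply: ler_sum => l _; case/andP: (QP i l) => ? ?; case/andP: (IH l) => ? ?.
exact: ler_pM.
Qed.

Lemma zero_col_expr_col k i : (0 < k)%N -> (Q ^+ k) i xstar = 0.
Proof.
case: k => // k _; rewrite exprSr -mulmxE mxE big1// => l _.
by rewrite [Q l xstar]mxE eqxx mulr0.
Qed.

(** Irreducibility may yield only [k = 0] when [i = xstar]. A positive return time still exists
    then: otherwise 2 would vacuously be a common divisor of the return times, against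
    aperiodicity. *)
Lemma exists_expr_gt0 i : irreducible P -> aperiodic P ->
  exists2 k, (0 < k)%N & 0 < (P ^+ k) i xstar.
Proof.
move=> irr aper; have [k Pk] := irr i xstar.
case: k Pk => [|k] Pk; last by exists k.+1.
have -> : i = xstar.
  apply/eqP; case: eqVneq Pk => // ix.
  by rewrite expr0 mxE (negbTE ix) ltxx.
apply: contrapT => noret.
suff : 2%N = 1%N by [].
apply: (aper xstar) => k k0 Pkk; exfalso; apply: noret; by exists k.
Qed.

(* Maximum principle: if [u = Q u] and [|u i|] is maximal, then
   [|u i| <= |u i| * (1 - (P ^+ k) i xstar)] for every [k > 0]. *)
Lemma unitmx_sub_zero_col : irreducible P -> aperiodic P ->
  1%:M - Q \in unitmx.
Proof.
move=> irr aper; rewrite -unitmx_tr -row_free_unit.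
apply: inj_row_free => v0 vQ.
pose u := v0^T.
have uQ : Q *m u = u.
  have : (1%:M - Q) *m u = 0.
    by rewrite -[LHS]trmxK trmx_mul trmxK vQ trmx0.
  by rewrite mulmxBl mul1mx => /eqP; rewrite subr_eq0 => /eqP.
have uQk k : (Q ^+ k) *m u = u.
  elim: k => [|k IH]; first by rewrite expr0 mul1mx.
  by rewrite exprSr -mulmxE -mulmxA uQ.
pose i := [arg max_(i > xstar) `|u i 0|]%O.
have imax j : `|u j 0| <= `|u i 0|.
  by rewrite /i; case: arg_maxP => //= l _; apply.
have [k k0 Pk] := exists_expr_gt0 i irr aper.
have : `|u i 0| <= `|u i 0| * (1 - (P ^+ k) i xstar).
  rewrite -{1}(uQk k) mxE (le_trans (ler_norm_sum _ _ _))//.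
  (* Since [k > 0], the term at [xstar] vanishes, and the remaining entries of [P ^+ k] in row [i]
     have total mass [1 - (P ^+ k) i xstar]. *)
  rewrite (bigD1 xstar)//= zero_col_expr_col// mul0r normr0 add0r.
  have -> : 1 - (P ^+ k) i xstar = \sum_(j | j != xstar) (P ^+ k) i j.
    by rewrite -(stochastic_expr_row_sum k i) (bigD1 xstar)//= addrAC subrr add0r.
  rewrite mulr_sumr ler_sum// => j _.
  have /andP[Q0 QP] := zero_col_expr_bounds k i j.
  by rewrite normrM (ger0_norm Q0) mulrC ler_pM.
rewrite mulrBr mulr1 lerBrDr gerDl pmulr_lle0// => ui0.
apply/matrixP => a j; rewrite (ord1 a) mxE; apply/normr0_eq0/le_anti.
rewrite normr_ge0 andbT (le_trans _ ui0)//.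
by have := imax j; rewrite {1}mxE.
Qed.
End KilledMatrix.

(** * Functions of the past of the chain *)

Section History.
Context (R : realType) (n : nat) (d : measure_display)
  (Omega : measurableType d) (x : nat -> Omega -> 'I_n).

(** Measurability with respect to the states at times 0 to [m], stated pointwise; for a finite state
    set the two notions agree. *)
Definition past (m : nat) (F : Omega -> R) : Prop :=
  forall w w', (forall i, (i <= m)%N -> x i w = x i w') -> F w = F w'.

Definition cylinder (m : nat) (h : nat -> 'I_n) : set Omega :=
  [set w | forall i, (i <= m)%N -> x i w = h i].

(* Histories up to time [m] form a finite type; beyond [m] the junk value is
   irrelevant. *)
Definition path_of (m : nat) (h : {ffun 'I_m.+1 -> 'I_n}) (i : nat) : 'I_n :=
  h (inord i).

Let history (m : nat) (w : Omega) : {ffun 'I_m.+1 -> 'I_n} :=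
  [ffun i : 'I_m.+1 => x i w].

Lemma in_cylinder m h w : cylinder m (path_of h) w <-> h = history m w.
Proof.
split=> [hw|-> i im]; last by rewrite /path_of ffunE inordK.
apply/ffunP => i; rewrite ffunE hw; last by rewrite -ltnS.
by rewrite /path_of inord_val.
Qed.

Lemma past_indic m F : past m F ->
  exists c : {ffun 'I_m.+1 -> 'I_n} -> R,
    forall w, F w = \sum_h c h * \1_(cylinder m (path_of h)) w.
Proof.
move=> pF.
(* The coefficient is the value of [F] at a chosen outcome with history [h], and 0 if no outcome has
   that history. *)
pose c h := match pselect (exists w, history m w = h) with
  | left e => F (projT1 (cid e)) | right _ => 0 end.
exists c => w; rewrite (bigD1 (history m w))//= big1 ?addr0 => [|h hw]; last first.
  by rewrite indicE memNset ?mulr0// => /in_cylinder hw'; rewrite hw' eqxx in hw.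
rewrite indicE mem_set ?mulr1; last exact/in_cylinder.
rewrite /c; case: pselect => [e|[]]; last by exists w.
case: cid => w' /= e'; apply: pF => i im.
have := congr1 (fun f : {ffun 'I_m.+1 -> 'I_n} => f (Ordinal (im : (i < m.+1)%N))) e'.
by rewrite !ffunE.
Qed.

Lemma pastW m m' F : (m <= m')%N -> past m F -> past m' F.
Proof. by move=> mm pF w w' e; apply: pF => i im; apply/e/(leq_trans im). Qed.

Lemma past_state m k (f : 'I_n -> R) : (k <= m)%N -> past m (fun w => f (x k w)).
Proof. by move=> km w w' -> . Qed.

Lemma past_cst m (c : R) : past m (fun=> c).
Proof. by []. Qed.

Lemma past_comp2 m (op : R -> R -> R) F G : past m F -> past m G ->
  past m (fun w => op (F w) (G w)).
Proof. by move=> pF pG w w' e; rewrite (pF w w')// (pG w w'). Qed.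

Context (mx : forall k j, measurable (x k @^-1` [set j])).

Lemma measurable_cylinder m h : measurable (cylinder m h).
Proof.
have -> : cylinder m h = \bigcap_(i in [set i | (i <= m)%N]) (x i @^-1` [set h i]).
  by apply/seteqP; split.
by apply: bigcap_measurableType.
Qed.

Lemma past_measurable m F : past m F -> measurable_fun [set: Omega] F.
Proof.
move=> /past_indic[c cF]; rewrite (_ : F = fun w =>
  \sum_h c h * \1_(cylinder m (path_of h)) w); last exact/funext.
apply: measurable_sum => h; apply: measurable_funM => //.
by apply: measurable_indic; apply: measurable_cylinder.
Qed.

Lemma past_integrable m F (mu : probability Omega R) : past m F ->
  mu.-integrable [set: Omega] (EFin \o F).
Proof.
move=> pF; have mF := past_measurable pF.
have [c cF] := past_indic pF.
apply: measurable_bounded_integrable => //.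
  exact: le_lt_trans (probability_le1 mu measurableT) (ltry _).
exists (\sum_h `|c h|); split; first by rewrite num_real.
move=> M cM w _ /=; apply/ltW; apply: le_lt_trans cM.
rewrite cF (le_trans (ler_norm_sum _ _ _))// ler_sum// => h _.
by rewrite normrM ler_piMr// indicE; case: (_ \in _); rewrite ?normr1 ?normr0.
Qed.

Lemma expectation_simple (mu : probability Omega R) (I : finType) (a : I -> R)
    (A : I -> set Omega) : (forall i, measurable (A i)) ->
  ('E_mu[(fun w => \sum_i a i * \1_(A i) w)%R])%E =
  (\sum_i a i * fine (mu (A i)))%:E.
Proof.
move=> mA; rewrite unlock.
under eq_integral do rewrite -sumEFin.
rewrite integral_sum//=; last first.
  move=> i; under eq_fun do rewrite EFinM.
  by apply: integrableZl => //; exact: integrable_indic.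
rewrite -sumEFin; apply: eq_bigr => i _.
under eq_integral do rewrite EFinM.
rewrite integralZl//; last exact: integrable_indic.
by rewrite integral_indic// setIT EFinM fineK// fin_num_measure.
Qed.
End History.

(** * The Markov property for the chain killed at [xstar] *)

Section KilledChain.
Context (R : realType) (n : nat) (xstar : 'I_n) (P : 'M[R]_n)
  (d : measure_display) (Omega : measurableType d)
  (Pr : 'I_n -> probability Omega R) (x : nat -> Omega -> 'I_n).
Context (chainP : markov_chain P Pr x).
Let Q := zero_col xstar P.

Local Notation "''Ex_' s [ F ]" := (fine (expectation (Pr s) F))
  (at level 5, s at level 0, F at level 200, format "''Ex_' s [ F ]").

Definition apply_mx (A : 'M[R]_n) (f : 'I_n -> R) (i : 'I_n) : R :=
  \sum_j A i j * f j.

(** Time 0 is not tested: a chain started at [xstar] is alive at time 0, as the passage time is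
    required to be positive. *)
Definition alive (m : nat) (w : Omega) : bool :=
  all (fun k => x k w != xstar) (iota 1 m).

Lemma aliveS m w : alive m.+1 w = alive m w && (x m.+1 w != xstar).
Proof. by rewrite /alive -[in iota 1 m.+1](addn1 m) iotaD all_cat /= andbT. Qed.

Lemma past_alive m : past x m (fun w => (alive m w)%:R : R).
Proof.
move=> w w' e; congr (_%:R); congr nat_of_bool; apply: eq_in_all => k.
by rewrite mem_iota add1n ltnS => /andP[_ km]; rewrite e.
Qed.

Let mx k j : measurable (x k @^-1` [set j]).
Proof. by case: chainP. Qed.

Lemma expectation_pastD m F G s : past x m F -> past x m G ->
  'Ex_s[fun w => F w + G w] = 'Ex_s[F] + 'Ex_s[G].
Proof.
move=> pF pG; rewrite unlock.
have iF := past_integrable mx (Pr s) pF.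
have iG := past_integrable mx (Pr s) pG.
under eq_integral do rewrite EFinD.
by rewrite integralD// fineD//; apply: integrable_fin_num.
Qed.

Lemma eq_expectation F G s : F =1 G -> 'Ex_s[F] = 'Ex_s[G].
Proof. by move=> /funext ->. Qed.

(** Both sides are finite sums over histories up to time [m], the left one refined by the state at
    time [m.+1]; they are compared term by term. *)
Lemma expectation_markov m F (f : 'I_n -> R) s : past x m F ->
  'Ex_s[fun w => F w * f (x m.+1 w)] =
  'Ex_s[fun w => F w * apply_mx P f (x m w)].
Proof.
move=> /(past_indic)[c cF].
pose C (h : {ffun 'I_m.+1 -> 'I_n}) := cylinder x m (path_of h).
have mC h : measurable (C h) by exact: measurable_cylinder.
rewrite (_ : (fun w => F w * apply_mx P f (x m w)) = fun w =>
    \sum_h (c h * apply_mx P f (h ord_max)) * \1_(C h) w); last first.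
  apply/funext => w; rewrite cF mulr_suml; apply: eq_bigr => h _.
  rewrite indicE; case: (boolP (w \in C h)) => [|_]; last by rewrite !mulr0 mul0r.
  rewrite inE => /(_ m (leqnn m)) -> /=; rewrite !mulr1 /path_of.
  by congr (_ * apply_mx _ _ (h _)); apply: val_inj; rewrite /= inordK.
rewrite (_ : (fun w => F w * f (x m.+1 w)) = fun w =>
    \sum_(hj : {ffun 'I_m.+1 -> 'I_n} * 'I_n)
      (c hj.1 * f hj.2) * \1_(C hj.1 `&` (x m.+1 @^-1` [set hj.2])) w); last first.
  apply/funext => w; rewrite cF mulr_suml.
  rewrite -(pair_bigA _ (fun h j => (c h * f j) * \1_(C h `&` (x m.+1 @^-1` [set j])) w))/=.
  apply: eq_bigr => h _; rewrite (bigD1 (x m.+1 w))//= big1 ?addr0.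
    rewrite !indicE in_setI (mem_set (_ : (x m.+1 @^-1` _) w))// andbT.
    by rewrite mulrAC.
  move=> j jx; rewrite indicE memNset ?mulr0// => -[_ /= xj].
  by rewrite xj eqxx in jx.
rewrite !expectation_simple//=; last first.
  by move=> hj; apply: measurableI.
rewrite -(pair_bigA _ (fun h j => (c h * f j) * fine (Pr s (C h `&` (x m.+1 @^-1` [set j])))))/=.
apply: eq_bigr => h _; rewrite /apply_mx -mulrA mulr_suml mulr_sumr.
apply: eq_bigr => j _; rewrite -mulrA; congr (_ * _).
(* The history [h] prolonged by the state [j], to which the defining clause of the chain applies. *)
pose h' i := if (i <= m)%N then path_of h i else j.
have [_ _ /(_ s m h')] := chainP.
have -> : [set w | forall i, (i <= m)%N -> x i w = h' i] = C h.
  by apply/seteqP; split => w /= hw i im; rewrite hw// /h' im.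
have -> : [set w | forall i, (i <= m.+1)%N -> x i w = h' i] =
    C h `&` (x m.+1 @^-1` [set j]).
  apply/seteqP; split => [w /= hw|w [/= hw xj] i].
    split=> [i im|/=]; first by rewrite hw ?leqW// /h' im.
    by rewrite hw// /h' ltnn.
  rewrite leq_eqVlt => /predU1P[->|]; first by rewrite xj /h' ltnn.
  by rewrite ltnS => im; rewrite hw// /h' im.
move=> ->; rewrite /h' leqnn ltnn fineM ?fin_num_measure//=.
rewrite /path_of (_ : inord m = ord_max); last by apply: val_inj; rewrite /= inordK.
by ring.
Qed.

(** Survival at time [m.+1] is absorbed into [f] by setting it to 0 at [xstar]; applying [P] to the
    modified function is applying [Q] to [f]. *)
Lemma expectation_killed m F (f : 'I_n -> R) s : past x m F ->
  'Ex_s[fun w => F w * ((alive m.+1 w)%:R * f (x m.+1 w))] =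
  'Ex_s[fun w => F w * ((alive m w)%:R * apply_mx Q f (x m w))].
Proof.
move=> pF.
pose f' j := if j == xstar then 0 else f j.
transitivity 'Ex_s[fun w => (F w * (alive m w)%:R) * f' (x m.+1 w)].
  apply: eq_expectation => w; rewrite aliveS /f'.
  by case: (alive m w); case: eqP => _ /=; ring.
rewrite expectation_markov; last first.
  by apply: (past_comp2 (fun a b => a * b)) => //; apply: past_alive.
apply: eq_expectation => w; rewrite -mulrA; congr (_ * (_ * _)).
apply: eq_bigr => j _; rewrite /f' mxE; case: ifP => _; ring.
Qed.

Lemma expectation_init (f : 'I_n -> R) s : 'Ex_s[fun w => f (x 0%N w)] = f s.
Proof.
have [_ x0 _] := chainP.
rewrite (_ : (fun w => f (x 0%N w)) = fun w =>
    \sum_j f j * \1_(x 0%N @^-1` [set j]) w); last first.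
  apply/funext => w; rewrite (bigD1 (x 0%N w))//= big1 ?addr0 => [|j jx].
    by rewrite indicE mem_set// mulr1.
  by rewrite indicE memNset ?mulr0// => /= xj; rewrite xj eqxx in jx.
rewrite expectation_simple//= (bigD1 s)//= big1 ?addr0.
  by rewrite (_ : _ @^-1` _ = [set w | x 0%N w = s])// x0 mulr1.
move=> j js; suff -> : Pr s (x 0%N @^-1` [set j]) = 0%E by rewrite mulr0.
apply/eqP; rewrite -measure_le0.
have <- : Pr s (~` [set w | x 0%N w = s]) = 0%E.
  by rewrite probability_setC ?x0 ?subee//; exact: (mx 0%N s).
apply: le_measure; rewrite ?inE//; first exact/measurableC/(mx 0%N s).
by move=> w /= -> /eqP; rewrite (negbTE js).
Qed.
End KilledChain.

(** * The stopped martingale and its compensated square *)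

Section Martingale.
Context (R : realType) (n : nat) (xstar : 'I_n) (P : 'M[R]_n)
  (d : measure_display) (Omega : measurableType d)
  (Pr : 'I_n -> probability Omega R) (x : nat -> Omega -> 'I_n).
Context (chainP : markov_chain P Pr x).
Let Q := zero_col xstar P.
Let al m w : R := (alive xstar x m w)%:R.

Local Notation "''Ex_' s [ F ]" := (fine (expectation (Pr s) F))
  (at level 5, s at level 0, F at level 200, format "''Ex_' s [ F ]").

(** For [r = 1] this is the passage time truncated at [m]. *)
Definition killed_reward (r : 'I_n -> R) (m : nat) (w : Omega) : R :=
  \sum_(0 <= k < m) (alive xstar x k w)%:R * r (x k w).

Definition mart (r J : 'I_n -> R) (m : nat) (w : Omega) : R :=
  killed_reward r m w + (alive xstar x m w)%:R * J (x m w).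

Lemma past_killed m (f : 'I_n -> R) : past x m (fun w => al m w * f (x m w)).
Proof.
apply: (past_comp2 (fun a b => a * b)); first exact: past_alive.
exact: (past_state f).
Qed.

Lemma past_killed_reward r m : past x m (killed_reward r m).
Proof.
move=> w w' e; rewrite /killed_reward !big_mkord; apply: eq_bigr => k _.
by apply: (past_killed (m := k) r) => i ik; apply/e/(leq_trans ik)/ltnW.
Qed.

(** The last summand is at time [m], so the sum is predictable and can serve as a coefficient in the
    Markov step. *)
Lemma past_killed_rewardS r m : past x m (killed_reward r m.+1).
Proof.
move=> w w' e; rewrite /killed_reward !big_mkord; apply: eq_bigr => k _.
by apply: (past_killed (m := k) r) => i ik; apply/e/(leq_trans ik); rewrite -ltnS.
Qed.

Lemma killed_reward1_ge0 m w : 0 <= killed_reward (fun=> 1) m w.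
Proof. by apply: sumr_ge0 => k _; rewrite mulr1 ler0n. Qed.

Lemma past_mart r J m : past x m (mart r J m).
Proof.
apply: (past_comp2 (fun a b => a + b)); first exact: past_killed_reward.
exact: past_killed.
Qed.

(** One Markov step for both moments: [A] and [B] collect what is known at time [m]. The square
    needs the cross term in [B]; the first moment takes [B = 0]. *)
Lemma expectation_killed2 m A B (f g : 'I_n -> R) s :
  past x m A -> past x m B ->
  'Ex_s[fun w => A w + B w * (al m.+1 w * f (x m.+1 w)) + al m.+1 w * g (x m.+1 w)] =
  'Ex_s[fun w => A w + B w * (al m w * apply_mx Q f (x m w)) + al m w * apply_mx Q g (x m w)].
Proof.
move=> pA pB.
have split k (f' g' : 'I_n -> R) : (m <= k)%N ->
    'Ex_s[fun w => A w + B w * (al k w * f' (x k w)) + al k w * g' (x k w)] =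
    'Ex_s[A] + 'Ex_s[fun w => B w * (al k w * f' (x k w))] +
    (* The factor 1 gives this term the shape required by [expectation_killed]. *)
    'Ex_s[fun w => 1 * (al k w * g' (x k w))].
  move=> mk; have pA' := pastW mk pA; have pB' := pastW mk pB.
  have pBf : past x k (fun w => B w * (al k w * f' (x k w))).
    by apply: (past_comp2 (fun a b => a * b)) => //; exact: past_killed.
  rewrite (expectation_pastD (m := k) chainP (F := fun w => A w + _))//.
  - rewrite (expectation_pastD (m := k) chainP)//; congr (_ + _).
    by apply: eq_expectation => w; rewrite mul1r.
  - exact: (past_comp2 (fun a b => a + b)).
  - exact: past_killed.
by rewrite !split// !(expectation_killed xstar chainP).
Qed.

Lemma expectation_mart r J s m :
  (forall i, J i = r i + apply_mx Q J i) -> 'Ex_s[mart r J m] = J s.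
Proof.
move=> JE; elim: m => [|m <-].
  rewrite -(expectation_init chainP J); apply: eq_expectation => w.
  by rewrite /mart /killed_reward big_geq// add0r mul1r.
have := @expectation_killed2 m (killed_reward r m.+1) (fun=> 0) (fun=> 0) J s.
rewrite (eq_expectation Pr (G := mart r J m.+1)) => [->|w]; last first.
- by rewrite mul0r addr0.
- exact: past_cst.
- exact: past_killed_rewardS.
apply: eq_expectation => w; rewrite mul0r addr0.
by rewrite /mart /killed_reward big_nat_recr//= (JE (x m w)) /al; ring.
Qed.

(* The square of the martingale is compensated by the conditional variance of
   its increments, and [S] is the potential of that variance. *)
Lemma expectation_mart_square r J S s m :
  (forall i, J i = r i + apply_mx Q J i) ->
  (forall i, S i = apply_mx Q (fun j => J j ^+ 2) i - apply_mx Q J i ^+ 2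
                   + apply_mx Q S i) ->
  'Ex_s[fun w => (mart r J m w - J s) ^+ 2 + al m w * S (x m w)] = S s.
Proof.
move=> JE SE; elim: m => [|m IH].
  rewrite -[RHS](_ : (J s - J s) ^+ 2 + S s = _); last by rewrite subrr expr0n add0r.
  rewrite -(expectation_init chainP (fun j => (J j - J s) ^+ 2 + S j)).
  apply: eq_expectation => w.
  by rewrite /mart /killed_reward big_geq// add0r /al !mul1r.
rewrite -[RHS]IH.
have pZ := past_killed_rewardS r (m := m).
(* [Z] is known at time [m]. As the indicator of survival is its own square, expanding the square
   leaves the coefficients [Z ^+ 2] and [2 * Z], and [J ^+ 2] joins [S]. *)
pose Z w := killed_reward r m.+1 w - J s.
have := @expectation_killed2 m (fun w => Z w ^+ 2) (fun w => 2 * Z w) J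
  (fun j => J j ^+ 2 + S j) s.
rewrite (eq_expectation Pr (G := fun w =>
    (mart r J m.+1 w - J s) ^+ 2 + al m.+1 w * S (x m.+1 w))); last first.
  by move=> w; rewrite /mart /Z /al; case: (alive _ _ _ _) => /=; ring.
move=> ->; first last.
- by move=> w w' e; rewrite /Z (pZ w w' e).
- by move=> w w' e; rewrite /Z (pZ w w' e).
apply: eq_expectation => w; rewrite /mart /Z /killed_reward big_nat_recr//=.
have -> : apply_mx Q (fun j => J j ^+ 2 + S j) (x m w) =
    apply_mx Q (fun j => J j ^+ 2) (x m w) + apply_mx Q S (x m w).
  by rewrite /apply_mx -big_split; apply: eq_bigr => j _; rewrite /= mulrDr.
rewrite (SE (x m w)) (JE (x m w)) /al; case: (alive _ _ _ _) => /=; ring.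
Qed.
End Martingale.

(** * A uniform second-moment bound for the truncated passage times *)

Section PassageTime.
Context (R : realType) (n : nat) (xstar : 'I_n) (P : 'M[R]_n)
  (d : measure_display) (Omega : measurableType d)
  (Pr : 'I_n -> probability Omega R) (x : nat -> Omega -> 'I_n).
Context (chainP : markov_chain P Pr x).
Let Q := zero_col xstar P.
Context (unitQ : 1%:M - Q \in unitmx).

Local Notation "''Ex_' s [ F ]" := (fine (expectation (Pr s) F))
  (at level 5, s at level 0, F at level 200, format "''Ex_' s [ F ]").

Let mx k j : measurable (x k @^-1` [set j]).
Proof. by case: chainP. Qed.

Lemma exists_potential (b : 'I_n -> R) :
  exists f : 'I_n -> R, forall i, f i = b i + apply_mx Q f i.
Proof.
pose v : 'cV_n := invmx (1%:M - Q) *m \col_i b i.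
exists (fun i => v i 0) => i.
have : (1%:M - Q) *m v = \col_i b i by rewrite mulKVmx.
rewrite mulmxBl mul1mx => /(congr1 (fun u : 'cV_n => u i 0)).
by rewrite !mxE => <-; rewrite /apply_mx; ring.
Qed.

Lemma ler_norm_sum1 (f : 'I_n -> R) i : `|f i| <= \sum_j `|f j|.
Proof. by rewrite (bigD1 i)//= lerDl sumr_ge0. Qed.

(** The added 1 makes this at least 1, so that its multiples dominate constant, linear and quadratic
    terms in the truncated passage time alike. *)
Definition majorant (m : nat) (w : Omega) : R :=
  (killed_reward xstar x (fun=> 1) m w + 1) ^+ 2.

Let tot m w := killed_reward xstar x (fun=> 1 : R) m w.

Let tot_ge0 m w : 0 <= tot m w.
Proof. exact: killed_reward1_ge0. Qed.

Lemma majorant_ge1 m w : 1 <= majorant m w.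
Proof. by rewrite /majorant expr_ge1// ?addr_ge0// lerDr tot_ge0. Qed.

Lemma majorant_homo w : {homo majorant^~ w : m m' / (m <= m')%N >-> m <= m'}.
Proof.
apply: homo_leq => [m|y x' z|m]; [by []|exact: le_trans|].
rewrite /majorant -/(tot m w) -/(tot m.+1 w).
have -> : tot m.+1 w = tot m w + (alive xstar x m w)%:R.
  by rewrite /tot /killed_reward big_nat_recr//= mulr1.
by rewrite lerXn2r ?nnegrE ?addr_ge0 ?tot_ge0// lerD2r lerDl.
Qed.

Lemma past_majorant m : past x m (majorant m).
Proof.
by move=> w w' e; rewrite /majorant (past_killed_reward xstar (fun=> 1) e).
Qed.

(** Let [t] be the truncated passage time and [y] the surviving term of the martingale for [r = 1].
    Then [t + 1] is the sum of [t + y - J s], whose square is [N] up to a bounded term, and of the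
    bounded [1 + J s - y]. Here [N] has constant expectation [S s]. *)
Lemma expectation_majorant s : exists K, forall m, 'Ex_s[majorant m] <= K.
Proof.
have [J JE] := exists_potential (fun=> 1).
have [S SE] := exists_potential
  (fun i => apply_mx Q (fun j => J j ^+ 2) i - apply_mx Q J i ^+ 2).
pose CJ := \sum_j `|J j|; pose CS := \sum_j `|S j|.
(* [2 * CS] pays for replacing the squared martingale by [N], and the other term bounds
   [2 * (1 + J s - y) ^+ 2]. *)
pose K := 2 * CS + 2 * (1 + 2 * CJ) ^+ 2.
exists (2 * S s + K) => m.
pose N w := (mart xstar x (fun=> 1) J m w - J s) ^+ 2 +
  (alive xstar x m w)%:R * S (x m w).
have pN : past x m N.
  move=> w w' e; rewrite /N (past_mart xstar (fun=> 1) J e).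
  by rewrite (past_killed xstar S e).
rewrite -(expectation_mart_square chainP s m JE SE) -/N.
have -> : 2 * 'Ex_s[N] + K = 'Ex_s[fun w => (N w + N w) + K].
  rewrite (expectation_pastD (m := m) chainP (F := fun w => N w + N w) (G := cst K))//.
  - by rewrite (expectation_pastD (m := m) chainP (F := N) (G := N))// expectation_cst/= mulr_natl mulr2n.
  - exact: (past_comp2 (fun a b => a + b)).
have iF := past_integrable mx (Pr s) (past_majorant (m:=m)).
have iG := past_integrable mx (Pr s) (F := fun w => (N w + N w) + K) (m := m).
rewrite unlock; apply: le_Rintegral => //.
  by apply: iG => w w' e; rewrite (pN w w' e).
move=> w _; rewrite /majorant /N /mart -/(tot m w).
have /= Jx := ler_norm_sum1 J (x m w); have /= Js := ler_norm_sum1 J s.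
have /= Sx := ler_norm_sum1 S (x m w).
rewrite -/CJ -/CS !ler_norml in Jx Js Sx.
rewrite /K; move: (tot m w) => t.
set y := (alive xstar x m w)%:R * J (x m w); set z := _ * S (x m w).
have y1 : - CJ <= y <= CJ by rewrite /y; case: (alive _ _ _ _) => /=; lra.
have z1 : - CS <= z <= CS by rewrite /z; case: (alive _ _ _ _) => /=; lra.
have : (1 + J s - y) ^+ 2 <= (1 + 2 * CJ) ^+ 2.
  by rewrite -subr_ge0 subr_sqr mulr_ge0//; lra.
have : 0 <= (t + y - J s - (1 + J s - y)) ^+ 2 by exact: sqr_ge0.
(* The parallelogram identity for the two summands of [t + 1]. *)
have -> : (t + 1) ^+ 2 = 2 * (t + y - J s) ^+ 2 + 2 * (1 + J s - y) ^+ 2 -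
  (t + y - J s - (1 + J s - y)) ^+ 2 by ring.
lra.
Qed.
End PassageTime.

(** * Almost sure finiteness of the passage time, and passage to the limit *)

Section Majorant.
Context (R : realType) (n : nat) (xstar : 'I_n) (P : 'M[R]_n)
  (d : measure_display) (Omega : measurableType d)
  (Pr : 'I_n -> probability Omega R) (x : nat -> Omega -> 'I_n).
Context (chainP : markov_chain P Pr x).
Let Q := zero_col xstar P.
Context (unitQ : 1%:M - Q \in unitmx).

Local Notation "''Ex_' s [ F ]" := (fine (expectation (Pr s) F))
  (at level 5, s at level 0, F at level 200, format "''Ex_' s [ F ]").

Let mx k j : measurable (x k @^-1` [set j]).
Proof. by case: chainP. Qed.

Definition visited (w : Omega) : Prop :=
  exists k, (0 < k)%N && (x k w == xstar).

(** The square of the passage time plus 1; it is infinite exactly where [xstar] is never visited,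
    hence the extended reals. *)
Definition sup_majorant (w : Omega) : \bar R :=
  limn (fun m => (majorant R xstar x m w)%:E).

Lemma le_sup_majorant m w : ((majorant R xstar x m w)%:E <= sup_majorant w)%E.
Proof.
rewrite /sup_majorant; set u := fun m => _.
have u_homo : {homo u : n m / (n <= m)%N >-> (n <= m)%E}.
  by move=> a b ab; rewrite lee_fin majorant_homo.
rewrite (cvg_lim _ (ereal_nondecreasing_cvgn u_homo))//.
by apply: ereal_sup_ubound; exists m.
Qed.

Lemma integrable_sup_majorant s :
  (Pr s).-integrable [set: Omega] sup_majorant.
Proof.
pose u m w := (majorant R xstar x m w)%:E.
have u_homo w : {homo u^~ w : n m / (n <= m)%N >-> (n <= m)%E}.
  by move=> a b ab; rewrite lee_fin majorant_homo.
have u0 m w : (0 <= u m w)%E.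
  by rewrite lee_fin (le_trans ler01)// majorant_ge1.
have mu m : measurable_fun [set: Omega] (u m).
  by apply/measurable_EFinP; apply: (past_measurable mx); apply: past_majorant.
have uS w : u^~ w @ \oo --> sup_majorant w.
  by apply: ereal_nondecreasing_is_cvgn.
have S0 w : (0 <= sup_majorant w)%E by apply: le_trans (u0 0%N w) (le_sup_majorant 0 w).
apply/integrableP; split.
  by apply: (emeasurable_fun_cvg u) => // w _; exact: uS.
under eq_integral do rewrite gee0_abs//.
have [K EK] := expectation_majorant chainP unitQ s.
apply: (@le_lt_trans _ _ K%:E); last exact: ltry.
rewrite (monotone_convergence (Pr s) measurableT (g' := u))//.
apply: lime_le.
  apply: ereal_nondecreasing_is_cvgn => a b ab.
  by apply: ge0_le_integral => // w _; apply: u_homo.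
apply: nearW => m.
have iu := past_integrable mx (Pr s) (past_majorant R xstar (x := x) (m := m)).
rewrite -(fineK (integrable_fin_num measurableT iu)) lee_fin.
by have := EK m; rewrite unlock.
Qed.

Lemma sup_majorant_visited w : sup_majorant w \is a fin_num -> visited w.
Proof.
move=> Sfin; apply: contrapT => novisit.
have alw m : alive xstar x m w.
  apply/allP => k; rewrite mem_iota => /andP[k0 _]; apply/negP => xk.
  by apply: novisit; exists k; rewrite k0.
have totE m : killed_reward xstar x (fun=> 1 : R) m w = m%:R.
  rewrite /killed_reward (eq_bigr (fun=> 1)) => [|k _]; last by rewrite alw mulr1.
  by rewrite big_const_nat subn0 iter_addr addr0.
pose a := fine (sup_majorant w).
(* Without a visit the truncated passage time at [m] is [m], so at the Archimedean bound of [a] the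
   majorant already exceeds its own supremum [a]. *)
have := le_sup_majorant (Num.bound a) w.
rewrite -(fineK Sfin) lee_fin -/a leNgt => /negP; apply.
apply: lt_le_trans (archi_boundP _) _.
  by rewrite fine_ge0// (le_trans _ (le_sup_majorant 0 w))// lee_fin (le_trans ler01)// majorant_ge1.
rewrite /majorant totE; have : 0 <= (Num.bound a)%:R :> R by [].
by nra.
Qed.

Lemma ae_visited s : {ae Pr s, forall w, visited w}.
Proof.
have := integrable_ae measurableT (integrable_sup_majorant s).
by apply: filterS => w /(_ I); exact: sup_majorant_visited.
Qed.

(** Dominated convergence with [C * sup_majorant] as dominating function: almost every path visits
    [xstar], after which [F] eventually equals [G]. *)
Lemma expectation_frozen (F : nat -> Omega -> R) (G : Omega -> R) C c s :
  (forall m, past x m (F m)) -> measurable_fun [set: Omega] G ->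
  (forall m w, `|F m w| <= C * majorant R xstar x m w) ->
  (forall w, visited w -> \forall m \near \oo, F m w = G w) ->
  (forall m, 'Ex_s[F m] = c) -> expectation (Pr s) G = c%:E.
Proof.
move=> pF mG FC FG Fc.
(* The domination at a single outcome forces this, and an outcome exists because [Omega] has mass
   1. *)
have C0 : 0 <= C.
  have [w _] : exists w : Omega, True.
    apply: contrapT => noW.
    have : Pr s setT = 0%E.
      rewrite (_ : setT = set0) ?measure0//; apply/seteqP; split => // w _.
      by apply: noW; exists w.
    by rewrite probability_setT => /eqP; rewrite onee_eq0.
  have := FC 0%N w; have := majorant_ge1 R xstar x 0%N w.
  have := normr_ge0 (F 0%N w); nra.
have iF m := past_integrable mx (Pr s) (pF m).
have [] := @dominated_convergence _ _ _ (Pr s) setT measurableT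
  (fun m w => (F m w)%:E) (EFin \o G) (fun w => C%:E * sup_majorant w)%E.
- move=> m; by apply/measurable_EFinP; apply: (past_measurable mx); apply: pF.
- exact/measurable_EFinP.
- apply: filterS (ae_visited s) => w /FG FGw _.
  by apply: cvg_near_cst; apply: filterS FGw => m /= ->.
- exact/integrableZl/integrable_sup_majorant.
- apply: aeW => w m _; rewrite [leLHS](_ : _ = `|F m w|%:E)%E//.
  apply: (@le_trans _ _ (C * majorant R xstar x m w)%:E); first by rewrite lee_fin.
  by rewrite EFinM lee_wpmul2l ?lee_fin ?le_sup_majorant.
move=> _ _ cvgF; rewrite unlock.
apply: (cvg_unique (@ereal_hausdorff R) cvgF).
apply: cvg_near_cst; apply: nearW => m /=.
by rewrite -(fineK (integrable_fin_num measurableT (iF m))) -(Fc m) unlock.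
Qed.

(** * The accumulated reward as a limit of truncated rewards *)

Section AccReward.
Context (r : 'cV[R]_n).

Lemma killed_acc_reward w : visited w ->
  \forall m \near \oo, ~~ alive xstar x m w /\
    killed_reward xstar x (fun j => r j 0) m w = acc_reward xstar r x w.
Proof.
move=> vis; rewrite /acc_reward /first_passage; case: pselect => // vis'.
case: ex_minnP => t /andP[t0 xt] tmin.
(* With [t] the passage time, survival up to [k] means [k < t]; the truncated reward thus stops
   changing from time [t] on. *)
have alt k : alive xstar x k w = (k < t)%N.
  apply/allP/idP => [|kt j]; last first.
    rewrite mem_iota add1n ltnS => /andP[j0 jk]; apply/negP => xj.
    have := tmin j; rewrite j0 xj => /(_ isT).
    by rewrite leqNgt (leq_ltn_trans jk).
  rewrite ltnNge; apply: contraPN => tk /(_ t).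
  by rewrite mem_iota t0 add1n ltnS tk xt => /(_ isT).
exists t => // m /= tm; rewrite alt -leqNgt; split=> //.
rewrite /killed_reward (big_cat_nat _ (n := t))//= [X in _ + X]big1_seq ?addr0.
  rewrite !big_nat; apply: eq_bigr => k /= kt; by rewrite alt kt mul1r.
move=> k /= ; rewrite mem_index_iota => /andP[tk _].
by rewrite alt ltnNge tk mul0r.
Qed.

(** The indicator of [visited] makes the truncated rewards converge everywhere: off this event the
    junk passage time 0 turns the accumulated reward into an empty sum. *)
Lemma measurable_acc_reward : measurable_fun [set: Omega] (acc_reward xstar r x).
Proof.
have mV : measurable [set w | visited w].
  rewrite (_ : mkset _ = \bigcup_(k in [set k | (0 < k)%N]) (x k @^-1` [set xstar])).
    by apply: bigcup_measurable => k _.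
  apply/seteqP; split=> [w [k /andP[k0 /eqP xk]]|w [k k0 xk]]; first by exists k.
  by exists k; rewrite k0; apply/eqP.
apply: (@measurable_fun_cvg _ _ _ _ (fun m w =>
    killed_reward xstar x (fun j => r j 0) m w * \1_[set w | visited w] w)).
  move=> m; apply: measurable_funM; last exact: measurable_indic.
  by apply: (past_measurable mx); apply: past_killed_reward.
move=> w _; apply: cvg_near_cst.
case: (pselect (visited w)) => [vis|novis].
  apply: filterS (killed_acc_reward vis) => m [_ ->].
  by rewrite indicE mem_set// mulr1.
apply: nearW => m; rewrite indicE memNset// mulr0.
by rewrite /acc_reward /first_passage; case: pselect => // _; rewrite big_geq.
Qed.
End AccReward.
End Majorant.

(** * Mean and variance of the accumulated reward *)

Section Moments.
Context (R : realType) (n : nat) (xstar : 'I_n) (P : 'M[R]_n)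
  (d : measure_display) (Omega : measurableType d)
  (Pr : 'I_n -> probability Omega R) (x : nat -> Omega -> 'I_n).
Context (chainP : markov_chain P Pr x).
Let Q := zero_col xstar P.
Context (unitQ : 1%:M - Q \in unitmx).

(** Linear growth in the truncated passage time, so that the martingale and its square are both
    dominated by multiples of [majorant]. *)
Lemma norm_mart_le (r J : 'I_n -> R) m w :
  `|mart xstar x r J m w| <= (\sum_j `|r j| + \sum_j `|J j|) *
    (killed_reward xstar x (fun=> 1) m w + 1).
Proof.
have tot0 : 0 <= killed_reward xstar x (fun=> 1 : R) m w.
  exact: killed_reward1_ge0.
have rle : `|killed_reward xstar x r m w| <=
    (\sum_j `|r j|) * killed_reward xstar x (fun=> 1) m w.
  rewrite /killed_reward (le_trans (ler_norm_sum _ _ _))// mulr_sumr ler_sum//.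
  move=> k _; rewrite normrM normr_nat mulr1 mulrC.
  by rewrite ler_wpM2r ?ler0n ?ler_norm_sum1.
have Jle : `|(alive xstar x m w)%:R * J (x m w)| <= \sum_j `|J j|.
  rewrite normrM normr_nat; case: (alive _ _ _ _).
    by rewrite mul1r ler_norm_sum1.
  by rewrite mul0r sumr_ge0.
have r0 : 0 <= \sum_j `|r j| by exact: sumr_ge0.
have J0 : 0 <= \sum_j `|J j| by exact: sumr_ge0.
rewrite (le_trans (ler_normD _ _))//; nra.
Qed.

Lemma expectation_acc_reward (r : 'cV[R]_n) J s :
  (forall i, J i = r i 0 + apply_mx Q J i) ->
  expectation (Pr s) (acc_reward xstar r x) = (J s)%:E.
Proof.
move=> JE; pose r' i := r i 0.
apply: (expectation_frozen chainP unitQ (F := mart xstar x r' J)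
  (C := \sum_j `|r' j| + \sum_j `|J j|)).
- by move=> m; exact: past_mart.
- exact: (measurable_acc_reward xstar chainP r).
- move=> m w; apply: le_trans (norm_mart_le _ _ _ _) _.
  rewrite ler_wpM2l ?addr_ge0 ?sumr_ge0// /majorant ler_eXnr// lerDr.
  exact: killed_reward1_ge0.
- move=> w vis; apply: filterS (killed_acc_reward r vis) => m [/negbTE dead <-].
  by rewrite /mart dead mul0r addr0.
- by move=> m; apply: (expectation_mart chainP).
Qed.

Lemma variance_acc_reward (r : 'cV[R]_n) J S s :
  (forall i, J i = r i 0 + apply_mx Q J i) ->
  (forall i, S i = apply_mx Q (fun j => J j ^+ 2) i - apply_mx Q J i ^+ 2
                   + apply_mx Q S i) ->
  variance (Pr s) (acc_reward xstar r x) = (S s)%:E.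
Proof.
move=> JE SE; pose r' i := r i 0.
rewrite /variance unlock (expectation_acc_reward s JE)/=.
pose c := \sum_j `|r' j| + \sum_j `|J j|.
apply: (expectation_frozen chainP unitQ
  (F := fun m w => (mart xstar x r' J m w - J s) ^+ 2 +
                   (alive xstar x m w)%:R * S (x m w))
  (* The first term comes from squaring the linear bound on the martingale minus [J s]; the second
     bounds the [S] term, as the majorant is at least 1. *)
  (C := (c + \sum_j `|J j|) ^+ 2 + \sum_j `|S j|)).
- move=> m w w' e; rewrite (past_mart xstar r' J e).
  by rewrite (past_killed xstar S e).
- have mB := measurable_acc_reward xstar chainP r.
  by apply: measurable_funM; apply: measurable_funB.
- move=> m w; rewrite /majorant.
  have := norm_mart_le r' J m w; rewrite -/c.
  have : 0 <= killed_reward xstar x (fun=> 1 : R) m w.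
    exact: killed_reward1_ge0.
  move: (killed_reward _ _ _ _ _) (mart _ _ _ _ _ _) => t y t0 yle.
  have Js := ler_norm_sum1 J s; have Sx := ler_norm_sum1 S (x m w).
  set CJ := \sum_j `|J j| in Js *; set CS := \sum_j `|S j| in Sx *.
  have CJ0 : 0 <= CJ by exact: sumr_ge0.
  have CS0 : 0 <= CS by exact: sumr_ge0.
  have c0 : 0 <= c by rewrite addr_ge0// sumr_ge0.
  rewrite (le_trans (ler_normD _ _))// mulrDl lerD//.
    rewrite normrX -exprMn lerXn2r ?nnegrE//.
      by rewrite mulr_ge0// addr_ge0.
    rewrite (le_trans (ler_normB _ _))// mulrDl lerD//.
    by rewrite (le_trans Js)// ler_peMr// lerDr.
  rewrite normrM normr_nat; apply: (@le_trans _ _ CS).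
    by case: (alive _ _ _ _); rewrite ?mul1r ?mul0r.
  by rewrite ler_peMr// expr_ge1 ?addr_ge0// lerDr.
- move=> w vis; apply: filterS (killed_acc_reward r vis) => m [/negbTE dead accE].
  by rewrite /mart dead !mul0r !addr0 accE expr2.
- by move=> m; apply: (expectation_mart_square chainP).
Qed.

Lemma potential_unique (b f : 'I_n -> R) :
  (forall i, f i = b i + apply_mx Q f i) ->
  \col_i f i = invmx (1%:M - Q) *m \col_i b i.
Proof.
move=> fE; rewrite -[LHS](mulKmx unitQ); congr (_ *m _).
apply/colP => i; rewrite mulmxBl mul1mx !mxE {1}fE /apply_mx.
rewrite [X in _ - X](_ : _ = \sum_j Q i j * f j) ?addrK//.
by apply: eq_bigr => j _; congr (_ * _); rewrite mxE.
Qed.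
End Moments.

Unset Implicit Arguments.
Set Strict Implicit.
Set Printing Implicit Defensive.

Theorem proposition3p1 (R : realType) (n : nat) (r : 'cV[R]_n)
    (xstar : 'I_n) (P : 'M[R]_n)
    (d : measure_display) (Omega : measurableType d)
    (Pr : 'I_n -> probability Omega R) (x : nat -> Omega -> 'I_n)
    (stochP : stochastic P)
    (chainP : markov_chain P Pr x)
    (ergP : ergodic P Pr x) :
  let P' := zero_col xstar P in
  let B := acc_reward xstar r x in
  let J := value_fun xstar r Pr x in
  let V := variance_fun xstar r Pr x in
  [/\ 1%:M - P' \in unitmx,
      forall s : 'I_n,
        ('E_(Pr s)[B] = (J s 0)%:E)%E /\ ('V_(Pr s)[B] = (V s 0)%:E)%E,
      J = invmx (1%:M - P') *m r &
      V = invmx (1%:M - P') *m rho_of P' J].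
Proof.
move=> P' B J V; have [irr _ aper] := ergP.
have unitP : 1%:M - P' \in unitmx := unitmx_sub_zero_col xstar stochP irr aper.
(* [f] and [g] are first obtained as solutions of the linear equations and only then identified with
   the mean and the variance. *)
have [f fE] := exists_potential unitP (fun i => r i 0).
have [g gE] := exists_potential unitP
  (fun i => apply_mx P' (fun j => f j ^+ 2) i - apply_mx P' f i ^+ 2).
have EB s := expectation_acc_reward chainP unitP s fE.
have VB s := variance_acc_reward chainP unitP s fE gE.
have JE : J = \col_i f i by apply/colP => s; rewrite !mxE EB.
have VE : V = \col_i g i by apply/colP => s; rewrite !mxE VB.
split=> //.
(* Both moments were computed as real numbers, so [fine] hides no infinite value. *)
- by move=> s; rewrite EB VB JE VE !mxE.
- rewrite JE (potential_unique unitP fE); congr (_ *m _).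
  by apply/colP => i; rewrite mxE.
- rewrite VE (potential_unique unitP gE); congr (_ *m _).
  apply/colP => i; rewrite !mxE JE /apply_mx.
  congr (_ - _ ^+ 2); by apply: eq_bigr => j _; rewrite mxE.
Qed.
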